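(* Let $G=\mathrm{SL}(2,\mathbb R)$, $\sigma\in\mathbb C$, $\varepsilon\in\{0,1\}$, $g\in G$. Let $F_g$ and $F_g^\natural$ be the covariant and contravariant symbols of the operator $T_{\sigma,\varepsilon}(g)$ (defined in the context), regarded as functions on the hyperboloid $\mathcal X$ through the horospherical coordinates $\xi,\eta$. Then they are the following functions: $$ F_g(x)=\big(\mathrm{tr}(xg)\big)^{2\sigma,\varepsilon}=\left(\frac{ugv}{uv}\right)^{2\sigma,\varepsilon}, $$ $$ F_g^\natural(x)=\big(\mathrm{tr}(g^{-1}x)\big)^{-2\sigma-2,\varepsilon}=\left(\frac{ug^{-1}v}{uv}\right)^{-2\sigma-2,\varepsilon}, $$ where $x\in\mathcal X$ is the point with horospherical coordinates $\xi,\eta$, $u=u(\xi)=\begin{pmatrix}\xi&1\end{pmatrix}$ and $v=v(\eta)=\begin{pmatrix}-\eta \\ 1\end{pmatrix}$. The identities are understood at all $(\xi,\eta)\in\mathbb R^2$ for which the expressions involved are defined.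
   Context: **Notation.** For $t\in\mathbb R\setminus\{0\}$, $\lambda\in\mathbb C$, $\varepsilon\in\{0,1\}$ put $t^{\lambda,\varepsilon}=|t|^\lambda(\mathrm{sgn}\,t)^\varepsilon$. Elements of $G=\mathrm{SL}(2,\mathbb R)$ are written $g=\begin{pmatrix}\alpha & \beta \\ \gamma & \delta\end{pmatrix}$, $\alpha\delta-\beta\gamma=1$, and $\widehat g=\begin{pmatrix}\delta & \gamma \\ \beta & \alpha\end{pmatrix}$. **Representations.** For $\sigma\in\mathbb C$, $\varepsilon\in\{0,1\}$, the operator $T_{\sigma,\varepsilon}(g)$ acts on functions $f$ of a real variable $t$ by $$\big(T_{\sigma,\varepsilon}(g)f\big)(t)=f\left(\frac{\alpha t+\gamma}{\beta t+\delta}\right)(\beta t+\delta)^{2\sigma,\varepsilon}.$$ The basic representation space is that of $f\in C^\infty(\mathbb R)$ such that $t\mapsto t^{2\sigma,\varepsilon}f(1/t)$ is also in $C^\infty(\mathbb R)$; below the same formula is applied to more general functions wherever it is defined. Consequently $$\big(T_{\sigma,\varepsilon}(\widehat g)f\big)(t)=f\left(\frac{\delta t+\beta}{\gamma t+\alpha}\right)(\gamma t+\alpha)^{2\sigma,\varepsilon}.$$ **The hyperboloid.** $\mathcal X$ is the one-sheeted hyperboloid $-x_1^2+x_2^2+x_3^2=1$ in $\mathbb R^3$, realized as the set of matrices $x=\frac12\begin{pmatrix}1-x_3 & x_2-x_1 \\ x_2+x_1 & 1+x_3\end{pmatrix}$ with $\det x=0$. The group $G$ acts on it by $x\mapsto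 g^{-1}xg$. Horospherical coordinates $\xi,\eta\in\mathbb R$ on $\mathcal X$, with $N=N(\xi,\eta)=1-\xi\eta\neq0$, are given by $$x=\frac1N\begin{pmatrix}-\eta\xi & -\eta \\ \xi & 1\end{pmatrix}.$$ With $u=u(\xi)=\begin{pmatrix}\xi&1\end{pmatrix}$ and $v=v(\eta)=\begin{pmatrix}-\eta \\ 1\end{pmatrix}$ one has $N=uv$ and $x=\dfrac{vu}{uv}$. **Symbols.** Let $\Phi_{\sigma,\varepsilon}(\xi,\eta)=N(\xi,\eta)^{2\sigma,\varepsilon}=(1-\xi\eta)^{2\sigma,\varepsilon}$. The covariant symbol and the contravariant symbol of $T_{\sigma,\varepsilon}(g)$ are defined respectively by $$F_g(\xi,\eta)=\frac{1}{\Phi_{\sigma,\varepsilon}(\xi,\eta)}\big(T_{\sigma,\varepsilon}(g)\otimes1\big)\Phi_{\sigma,\varepsilon}(\xi,\eta),$$ $$F_g^\natural(\xi,\eta)=\frac{1}{\Phi_{-\sigma-1,\varepsilon}(\xi,\eta)}\big(1\otimes T_{-\sigma-1,\varepsilon}(\widehat g)\big)\Phi_{-\sigma-1,\varepsilon}(\xi,\eta).$$ Here $A\otimes1$ means that $A$ acts on the variable $\xi$ with $\eta$ fixed, and $1\otimes A$ means that $A$ acts on the variable $\eta$ with $\xi$ fixed. *)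

(* Defs.v *)
From HB Require Import structures.
From mathcomp Require Import all_boot all_order all_algebra.
From mathcomp Require Import complex ring.
From mathcomp Require Import all_classical all_reals all_analysis.

Set Implicit Arguments.
Unset Strict Implicit.
Unset Printing Implicit Defensive.

Import Order.TTheory GRing.Theory Num.Theory.
Local Open Scope ring_scope.
Local Open Scope complex_scope.

Section Defs.
Variable R : realType.
Implicit Types (t xi eta : R) (z lambda sigma : R[i]) (eps : 'I_2).
Implicit Types (g x : 'M[R]_2).

Definition cexp z : R[i] :=
  (expR (complex.Re z))%:C * (cos (complex.Im z) +i* sin (complex.Im z)).

(* t^{lambda,eps} = |t|^lambda (sgn t)^eps, with |t|^lambda = e^(lambda ln |t|).
   Only meaningful for t != 0; the value at 0 is junk. *)
Definition gpow t lambda eps : R[i] :=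
  cexp (lambda * (ln `|t|)%:C) * (Num.sg t)%:C ^+ eps.

Definition mx22 (a b c d : R) : 'M[R]_2 :=
  \matrix_(i, j) (if i == 0 then (if j == 0 then a else b)
                  else (if j == 0 then c else d)).

Definition hatg g : 'M[R]_2 := mx22 (g 1 1) (g 1 0) (g 0 1) (g 0 0).

Definition mobius_den g t : R := g 0 1 * t + g 1 1.

Definition mobius g t : R := (g 0 0 * t + g 1 0) / mobius_den g t.

Definition Trep sigma eps g (f : R -> R[i]) : R -> R[i] :=
  fun t => f (mobius g t) * gpow (mobius_den g t) (2 * sigma) eps.

(* Points at which T_{sigma,eps}(g) f is defined, D being the domain of f. *)
Definition Trep_dom g (D : set R) : set R :=
  [set t | mobius_den g t != 0 /\ D (mobius g t)].

Definition hyperboloid : set 'M[R]_2 :=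
  [set x | exists x1 x2 x3 : R, - x1 ^+ 2 + x2 ^+ 2 + x3 ^+ 2 = 1 /\
     x = 2^-1 *: mx22 (1 - x3) (x2 - x1) (x2 + x1) (1 + x3)].

Definition hN xi eta : R := 1 - xi * eta.

Definition horo xi eta : 'M[R]_2 :=
  (hN xi eta)^-1 *: mx22 (- (eta * xi)) (- eta) xi 1.

Definition horo_coords x xi eta : Prop :=
  hN xi eta != 0 /\ x = horo xi eta.

Definition uvec xi : 'rV[R]_2 := \row_j (if j == 0 then xi else 1).
Definition vvec eta : 'cV[R]_2 := \col_i (if i == 0 then - eta else 1).

Definition Phi sigma eps xi eta : R[i] := gpow (hN xi eta) (2 * sigma) eps.

Definition cov_symbol sigma eps g xi eta : R[i] :=
  (Phi sigma eps xi eta)^-1 *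
  Trep sigma eps g (fun s => Phi sigma eps s eta) xi.

Definition contra_symbol sigma eps g xi eta : R[i] :=
  (Phi (- sigma - 1) eps xi eta)^-1 *
  Trep (- sigma - 1) eps (hatg g) (fun s => Phi (- sigma - 1) eps xi s) eta.

(* The symbols are defined at (xi, eta) when no zero base is raised to a power
   and no denominator vanishes. *)
Definition cov_dom g xi eta : Prop :=
  hN xi eta != 0 /\ Trep_dom g [set s | hN s eta != 0] xi.

Definition contra_dom g xi eta : Prop :=
  hN xi eta != 0 /\ Trep_dom (hatg g) [set s | hN xi s != 0] eta.

Lemma horo_hyperboloid x xi eta : horo_coords x xi eta -> hyperboloid x.
Proof.
rewrite /horo_coords /horo /hN => -[N0 ->].
exists ((xi + eta) / (1 - xi * eta)), ((xi - eta) / (1 - xi * eta)),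
  ((1 + xi * eta) / (1 - xi * eta)); split; first by field.
by apply/matrixP => i j; rewrite !mxE; case: (i == 0); case: (j == 0);
  rewrite /=; field; rewrite ?N0 ?pnatr_eq0.
Qed.

(* Hence functions of (xi, eta) are functions on the corresponding part of the
   hyperboloid. *)
Lemma horo_coords_inj x xi eta xi' eta' :
  horo_coords x xi eta -> horo_coords x xi' eta' -> xi = xi' /\ eta = eta'.
Proof.
move=> [N0 ->] [N0' /matrixP E].
have := E 1 1; have := E 1 0; have := E 0 1; rewrite !mxE /= !mulr1 !mulrN.
by move=> /oppr_inj e2 e1 e; move: e1 e2; rewrite -e;
  split; apply: (mulfI (invr_neq0 N0)).
Qed.

Lemma horoE xi eta :
  horo xi eta = ((uvec xi *m vvec eta) 0 0)^-1 *: (vvec eta *m uvec xi).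
Proof.
have -> : (uvec xi *m vvec eta) 0 0 = hN xi eta.
  by rewrite !mxE !big_ord_recl big_ord0 !mxE /= /hN; ring.
congr (_ *: _); apply/matrixP => i j; rewrite !mxE big_ord1 !mxE.
by case: (i == 0); case: (j == 0); ring.
Qed.

End Defs.

(* Main.v *)
(* |t|^lambda (sgn t)^eps is multiplicative in t != 0, so each symbol collapses to
   one generalized power, of base N(t', s) d / N(t, s), where t' = n / d is the
   Moebius image of t and N(t', s) d = d - s n. This numerator is ugv for the
   covariant symbol and, after exchanging the roles of xi and eta, u g^-1 v for
   the contravariant one; both equal traces because x = vu / uv. *)
Require Import Defs.
From HB Require Import structures.
From mathcomp Require Import all_boot all_order all_algebra.
From mathcomp Require Import complex ring.
From mathcomp Require Import all_classical all_reals all_analysis.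

Set Implicit Arguments.
Unset Strict Implicit.
Unset Printing Implicit Defensive.

Import Order.TTheory GRing.Theory Num.Theory.
Local Open Scope ring_scope.
Local Open Scope complex_scope.

Lemma cexpD (R : realType) (z w : R[i]) : cexp (z + w) = cexp z * cexp w.
Proof.
case: z w => [a b] [c d]; rewrite /cexp /= expRD cosD sinD.
by simpc; congr (_ +i* _); ring.
Qed.

Lemma cexp_neq0 (R : realType) (z : R[i]) : cexp z != 0.
Proof.
(* A zero of [cexp] at z would force 1 = [cexp 0] = [cexp z * cexp (- z)] = 0. *)
apply/eqP => z0; have := cexpD z (- z).
rewrite z0 mul0r subrr /cexp /= expR0 cos0 sin0 mul1r.
by move/eqP; rewrite oner_eq0.
Qed.

Lemma gpowM (R : realType) (lambda : R[i]) (eps : 'I_2) (s t : R) :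
  s != 0 -> t != 0 ->
  gpow (s * t) lambda eps = gpow s lambda eps * gpow t lambda eps.
Proof.
move=> s0 t0; rewrite /gpow normrM lnM ?posrE ?normr_gt0 // sgrM.
by rewrite rmorphD rmorphM /= mulrDr cexpD exprMn mulrACA.
Qed.

Lemma gpow_neq0 (R : realType) (lambda : R[i]) (eps : 'I_2) (t : R) :
  t != 0 -> gpow t lambda eps != 0.
Proof.
move=> t0; rewrite /gpow mulf_neq0 ?cexp_neq0 // expf_neq0 //.
by rewrite fmorph_eq0 sgr_eq0.
Qed.

(** Shape of either symbol once unfolded: n = N(t, s), m = N(t', s), and d is the Moebius
    denominator at t. The three nonvanishing conditions are those packed in [cov_dom] and
    [contra_dom]. *)
Lemma gpow_quotient (R : realType) (lambda : R[i]) (eps : 'I_2) (n m d : R) :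
  n != 0 -> m != 0 -> d != 0 ->
  (gpow n lambda eps)^-1 * (gpow m lambda eps * gpow d lambda eps) =
  gpow (m * d / n) lambda eps.
Proof.
move=> n0 m0 d0; apply: (mulfI (gpow_neq0 lambda eps n0)).
rewrite mulVKf ?gpow_neq0 // -!gpowM ?mulf_neq0 ?invr_neq0 //.
by rewrite [n * _]mulrC divfK.
Qed.

Lemma uv_hN (R : realType) (xi eta : R) :
  (uvec xi *m vvec eta) 0 0 = hN xi eta.
Proof. by rewrite !mxE !big_ord_recl big_ord0 !mxE /= /hN; ring. Qed.

(** Cyclicity turns tr(vuh) into the trace of the 1x1 matrix uhv. *)
Lemma tr_horo_mul (R : realType) (xi eta : R) (h : 'M[R]_2) :
  \tr (horo xi eta *m h) =
  (uvec xi *m h *m vvec eta) 0 0 / (uvec xi *m vvec eta) 0 0.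
Proof.
rewrite horoE -scalemxAl mxtraceZ -mulmxA mxtrace_mulC.
by rewrite [\tr _]big_ord1 mulrC.
Qed.

Lemma uhvE (R : realType) (xi eta : R) (h : 'M[R]_2) :
  (uvec xi *m h *m vvec eta) 0 0 =
  h 0 1 * xi + h 1 1 - eta * (h 0 0 * xi + h 1 0).
Proof.
rewrite !mxE !big_ord_recl big_ord0 !mxE !big_ord_recl !big_ord0 !mxE /=.
rewrite (_ : lift ord0 ord0 = 1); last exact/val_inj.
by ring.
Qed.

Lemma hN_mobiusM (R : realType) (g : 'M[R]_2) (s t : R) :
  mobius_den g s != 0 ->
  hN (mobius g s) t * mobius_den g s =
  mobius_den g s - t * (g 0 0 * s + g 1 0).
Proof. by move=> d0; rewrite /hN /mobius; field. Qed.

Lemma hNC (R : realType) (xi eta : R) : hN xi eta = hN eta xi.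
Proof. by rewrite /hN mulrC. Qed.

Lemma invmx_mx22 (R : realType) (g : 'M[R]_2) : \det g = 1 ->
  invmx g = mx22 (g 1 1) (- g 0 1) (- g 1 0) (g 0 0).
Proof.
move=> detg; have gU : g \in unitmx by rewrite unitmxE detg unitr1.
rewrite /invmx gU detg invr1 scale1r; apply/matrixP => i j.
have ord2P (k : 'I_2) : k = 0 \/ k = 1.
  by case: k => -[|[|]] // lt_k2; [left | right]; exact/val_inj.
have lift00 : lift 0 0 = 1 :> 'I_2 by exact/val_inj.
have lift10 : lift 1 0 = 0 :> 'I_2 by exact/val_inj.
rewrite mxE /cofactor det_mx11.
have [-> | ->] := ord2P i; have [-> | ->] := ord2P j;
  rewrite !mxE /= ?lift00 ?lift10; ring.
Qed.

(** With J = diag(-1, 1), [hatg g] is J (g^-1)^T J, v(eta) = J u(eta)^T and u(xi) = v(xi)^T J.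
    Transposing the scalar u(xi) g^-1 v(eta) thus gives u(eta) [hatg g] v(xi). *)
Lemma uinvmxv_hatg (R : realType) (xi eta : R) (g : 'M[R]_2) : \det g = 1 ->
  (uvec xi *m invmx g *m vvec eta) 0 0 =
  mobius_den (hatg g) eta - xi * (hatg g 0 0 * eta + hatg g 1 0).
Proof.
by move=> detg; rewrite uhvE invmx_mx22 // /mobius_den !mxE /=; ring.
Qed.

Theorem theorem1 (R : realType) (sigma : R[i]) (eps : 'I_2) (g : 'M[R]_2)
    (detg : \det g = 1) (x : 'M[R]_2) (xX : hyperboloid x) (xi eta : R)
    (hx : horo_coords x xi eta) :
  [/\ cov_dom g xi eta ->
        cov_symbol sigma eps g xi eta = gpow (\tr (x *m g)) (2 * sigma) eps,
      \tr (x *m g) != 0 ->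
        gpow (\tr (x *m g)) (2 * sigma) eps =
        gpow ((uvec xi *m g *m vvec eta) 0 0 / (uvec xi *m vvec eta) 0 0)
          (2 * sigma) eps,
      contra_dom g xi eta ->
        contra_symbol sigma eps g xi eta =
        gpow (\tr (invmx g *m x)) (- 2 * sigma - 2) eps
    & \tr (invmx g *m x) != 0 ->
        gpow (\tr (invmx g *m x)) (- 2 * sigma - 2) eps =
        gpow ((uvec xi *m invmx g *m vvec eta) 0 0 / (uvec xi *m vvec eta) 0 0)
          (- 2 * sigma - 2) eps].
Proof.
(* Moving g^-1 to the right of x lets [tr_horo_mul] treat both traces; the second and fourth claims
   then become reflexive. *)
have [N0 ->] := hx; rewrite [\tr (invmx g *m _)]mxtrace_mulC.
rewrite !tr_horo_mul; split=> //.
- rewrite uv_hN uhvE => -[_ [/= d0 m0]].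
  rewrite /cov_symbol /Trep /Phi (gpow_quotient _ _ N0 m0 d0).
  by rewrite hN_mobiusM.
(* Here the Moebius map acts on eta, the second argument of N, so the symmetry of N is needed to
   reach [hN_mobiusM]. *)
- rewrite uv_hN uinvmxv_hatg // => -[_ [/= d0]]; rewrite hNC => m0.
  rewrite /contra_symbol /Trep /Phi (hNC xi (mobius _ _)).
  rewrite (gpow_quotient _ _ N0 m0 d0) hN_mobiusM //.
  by have -> : 2 * (- sigma - 1) = - 2 * sigma - 2 by ring.
Qed.
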